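(* Let $R$ be a unital ring and $a,b,c\in R$. Then the following are equivalent: (1) $a$ is $(b,c)$-invertible; (2) $c$ is regular, $(ab)^{\circ}=b^{\circ}$ and $R=abR\oplus c^{\circ}$; (3) $b$ is regular, ${}^{\circ}(ca)={}^{\circ}c$ and $R=Rca\oplus {}^{\circ}b$.
   Context: For $x\in R$: $xR=\{xr\mid r\in R\}$, $Rx=\{rx\mid r\in R\}$, ${}^{\circ}x=\{r\in R\mid rx=0\}$, $x^{\circ}=\{r\in R\mid xr=0\}$. An element $x\in R$ is regular (written $x\in R^-$) if there exists $z\in R$ with $xzx=x$. The symbol $\oplus$ denotes the internal direct sum of one-sided ideals (sum equal to $R$, intersection $\{0\}$). For $a,b,c\in R$, an element $y\in R$ is the $(b,c)$-inverse of $a$ if $y\in (bRy)\cap (yRc)$, $yab=b$ and $cay=c$, where $bRy=\{bry\mid r\in R\}$ and $yRc=\{yrc\mid r\in R\}$; such $y$ is unique if it exists, and then $a$ is called $(b,c)$-invertible. *)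

(* Defs.v *)
From mathcomp Require Import all_boot ssralg.
From mathcomp Require Import boolp classical_sets.

Set Implicit Arguments.
Unset Strict Implicit.
Unset Printing Implicit Defensive.

Import GRing.Theory.
Local Open Scope classical_set_scope.
Local Open Scope ring_scope.

(* [pzRingType] is the class of unital associative rings, not necessarily
   commutative, with 1 = 0 allowed. *)

(* xR *)
Definition right_principal (R : pzRingType) (x : R) : set R :=
  [set x * r | r in [set: R]].

(* Rx *)
Definition left_principal (R : pzRingType) (x : R) : set R :=
  [set r * x | r in [set: R]].

(* {}^o x, the r such that r x = 0 *)
Definition left_annihilator (R : pzRingType) (x : R) : set R :=
  [set r | r * x = 0].

(* x^o, the r such that x r = 0 *)
Definition right_annihilator (R : pzRingType) (x : R) : set R :=
  [set r | x * r = 0].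

(* Von Neumann regularity; unrelated to [GRing.lreg] and [GRing.rreg], which
   express cancellability. *)
Definition regular_elt (R : pzRingType) (x : R) : Prop :=
  exists z : R, x * z * x = x.

(* R = I (+) J; only applied to I and J that are both right ideals or both
   left ideals. *)
Definition direct_sum_decomposition (R : pzRingType) (I J : set R) : Prop :=
  [set u + v | u in I & v in J] = [set: R] /\ I `&` J = [set 0].

(* bRc *)
Definition two_sided_multiples (R : pzRingType) (b c : R) : set R :=
  [set b * r * c | r in [set: R]].

Definition is_bc_inverse (R : pzRingType) (a b c y : R) : Prop :=
  [/\ (two_sided_multiples b y `&` two_sided_multiples y c) y,
      y * a * b = b & c * a * y = c].

Definition bc_invertible (R : pzRingType) (a b c : R) : Prop :=
  exists y : R, is_bc_inverse a b c y.

(* Main.v *)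
Require Import Defs.
From mathcomp Require Import all_boot ssralg.
From mathcomp Require Import boolp classical_sets.

Import GRing.Theory.
Local Open Scope classical_set_scope.
Local Open Scope ring_scope.

(** All three conditions are equivalent to the pair of memberships
    [b \in Rcab] and [c \in cabR] (lemma [bc_invertible_iff_factors]): if
    [b = ucab] and [c = cabv], then [bv = ucabv = uc] is the (b,c)-inverse.

    In the condition on right ideals, the sum decomposition applied to [1]
    gives [c \in cabR]; trivial intersection together with [(ab)^o = b^o] gives
    [cab] the same right annihilator as [b]; and regularity of [c] passes to
    [cab]. If [x] is an inner inverse of [cab], then [cab] annihilates
    [1 - x cab], hence so does [b], which puts [b] in [Rcab]. Conversely,
    [cabv = c] splits every [x] as [abvx + (x - abvx)], and [b = ucab] says that
    [cabr = 0] forces [br = 0]. This is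
    [regular_right_decomposition_iff_factors].

    The condition on left ideals is the one on right ideals for the triple
    [(a, c, b)] in the opposite ring, where the two memberships trade places. *)

Definition mutual_factors {R : pzRingType} (a b c : R) : Prop :=
  (exists u, b = u * (c * a * b)) /\ (exists v, c = c * a * b * v).

(** The right-hand side is symmetric under
    reversing products and exchanging [b] with [c], so the conditions on
    one-sided ideals need to be analysed on one side only. *)
Lemma bc_invertible_iff_factors {R : pzRingType} (a b c : R) :
  bc_invertible a b c <-> mutual_factors a b c.
Proof.
split=> [[y [[[r _ yl] [s _ yr]] yab cay]]|[[u bE] [v cE]]].
  split; first by exists (y * s); rewrite !mulrA yr yab.
  by exists (r * y); rewrite -{1}cay -{1}yl !mulrA.
have bv_uc : b * v = u * c by rewrite [in RHS]cE {1}bE !mulrA.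
have yab : b * v * a * b = b by rewrite bv_uc -!mulrA [c * _]mulrA -bE.
have cay : c * a * (b * v) = c by rewrite mulrA -cE.
(* The inverse is outer, [y = y a y], and each outer factor [y] may be read
   as [bv] or as [uc]. *)
have yay : b * v * a * (b * v) = b * v by rewrite mulrA yab.
exists (b * v); split=> //; split.
  by exists (v * a) => //; rewrite [b * (v * a)]mulrA yay.
by exists (a * u) => //; rewrite -mulrA -[a * u * c]mulrA -bv_uc mulrA yay.
Qed.

Lemma regular_right_decomposition_iff_factors {R : pzRingType} (a b c : R) :
  [/\ regular_elt c,
      right_annihilator (a * b) = right_annihilator b
    & direct_sum_decomposition
        (right_principal (a * b)) (right_annihilator c)]
  <-> mutual_factors a b c.
Proof.
split=> [[[z czc] annE [sumE capE]]|[[u bE] [v cE]]].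
  have [v cE] : exists v, c = c * a * b * v.
    have : [set: R] 1 by [].
    rewrite -sumE => -[_ [v _ <-] [w cw0 vw1]]; exists v.
    by rewrite -[LHS]mulr1 -vw1 mulrDr cw0 addr0 !mulrA.
  split; last by exists v.
  have b_ann r : c * a * b * r = 0 -> b * r = 0.
    move=> cabr0; suff : right_annihilator (a * b) r by rewrite annE.
    have : (right_principal (a * b) `&` right_annihilator c) (a * b * r).
      by split; [exists r | rewrite /right_annihilator /= !mulrA].
    by rewrite capE.
  exists (b * v * z).
  (* [vz] is an inner inverse of [cab]: [cab v z cab = c z c ab = cab]. *)
  have /b_ann : c * a * b * (1 - v * z * (c * a * b)) = 0.
    by rewrite mulrBr mulr1 !mulrA -cE czc subrr.
  by rewrite mulrBr mulr1 => /subr0_eq; rewrite !mulrA.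
have uc_bv : u * c = b * v by rewrite [in LHS]cE [in RHS]bE !mulrA.
have b_ann r : c * a * b * r = 0 -> b * r = 0.
  by move=> cabr0; rewrite bE -mulrA cabr0 mulr0.
split.
- (* [c (au) c = ca (uc) = ca (bv) = c]. *)
  by exists (a * u); rewrite -mulrA -[a * u * c]mulrA uc_bv !mulrA -cE.
- apply/seteqP; split=> r; rewrite /right_annihilator /= => r0.
    by apply: b_ann; rewrite -!mulrA [a * _]mulrA r0 mulr0.
  by rewrite -mulrA r0 mulr0.
- split; apply/seteqP; split=> //.
  + move=> x _; exists (a * b * (v * x)); first by exists (v * x).
    exists (x - a * b * (v * x)); last by rewrite addrC subrK.
    by rewrite /right_annihilator /= mulrBr !mulrA -cE subrr.
  + move=> x [[r _ <-] /= cabr0].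
    have br0 : b * r = 0 by apply: b_ann; rewrite -[RHS]cabr0 !mulrA.
    by rewrite -mulrA br0 mulr0.
  + move=> _ ->; split; last by rewrite /right_annihilator /= mulr0.
    by exists 0; rewrite ?mulr0.
Qed.

Lemma mutual_factors_converse {R : pzRingType} (a b c : R) :
  @mutual_factors R^c a c b <-> mutual_factors a b c.
Proof.
have prodE : (b : R^c) * (a : R^c) * (c : R^c) = c * a * b :> R by apply: mulrA.
by rewrite /mutual_factors prodE; split=> -[].
Qed.

Lemma regular_elt_converse {R : pzRingType} (x : R) :
  @regular_elt R^c x <-> regular_elt x.
Proof.
by split=> -[z xzx]; exists z; apply: etrans xzx;
  [symmetry|]; apply: (@mulrA R).
Qed.

(** Passing to the opposite ring exchanges left and right ideals and left and
    right annihilators definitionally; only regularity and the factorizations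
    need reassociating. *)
Lemma regular_left_decomposition_iff_factors {R : pzRingType} (a b c : R) :
  [/\ regular_elt b,
      left_annihilator (c * a) = left_annihilator c
    & direct_sum_decomposition
        (left_principal (c * a)) (left_annihilator b)]
  <-> mutual_factors a b c.
Proof.
have dual := @regular_right_decomposition_iff_factors R^c a c b.
split=> [[regb annE dec]|fac].
  apply/mutual_factors_converse/dual; split=> //.
  exact/regular_elt_converse.
by have /mutual_factors_converse/dual[/regular_elt_converse] := fac.
Qed.

Theorem theorem3p1 (R : pzRingType) (a b c : R) :
  [<-> bc_invertible a b c;
       [/\ regular_elt c,
           right_annihilator (a * b) = right_annihilator b
         & direct_sum_decomposition
             (right_principal (a * b)) (right_annihilator c)];
       [/\ regular_elt b,
           left_annihilator (c * a) = left_annihilator c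
         & direct_sum_decomposition
             (left_principal (c * a)) (left_annihilator b)]].
Proof.
tfae.
- by move/bc_invertible_iff_factors/regular_right_decomposition_iff_factors.
- by move/regular_right_decomposition_iff_factors
       /regular_left_decomposition_iff_factors.
- by move/regular_left_decomposition_iff_factors/bc_invertible_iff_factors.
Qed.
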